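(* Let $\xi$ be an ordinal. Fix $\varepsilon_1,\ldots,\varepsilon_n\in\mathbb{R}$ and bounded functions $f_1,\ldots,f_n:\Gamma_\xi\to\mathbb{R}$ such that for each $1\leqslant i\leqslant n$, $f_i$ is not $\varepsilon_i$-large. Then $$\inf_{t\in MAX(\Gamma_\xi)}\ \max_{1\leqslant i\leqslant n}\ \sum_{s\preceq t}\mathbb{P}_\xi(s)[f_i(s)-\varepsilon_i]\leqslant0.$$
   Context: Sequences are finite; $s\prec t$ ($s\preceq t$) means $s$ is a proper (not necessarily proper) initial segment of $t$; $s^\frown t$ is concatenation; $MAX(S)$ is the set of $\preceq$-maximal members of $S$. For an ordinal $\zeta$ and a sequence of ordinals, $\zeta+(\zeta_i)_{i=1}^n=(\zeta+\zeta_i)_{i=1}^n$; $\zeta+S=\{\zeta+s:s\in S\}$. Define sets of non-empty finite sequences of ordinals by: $\Gamma_0=\{(0)\}$; given $\Gamma_\xi$, $\Gamma_{\xi,1}=\Gamma_\xi$, $\Gamma_{\xi,n+1}=(\omega^\xi n+\Gamma_\xi)\cup\{t^\frown u:t\in MAX(\omega^\xi n+\Gamma_\xi),u\in\Gamma_{\xi,n}\}$, $\Gamma_{\xi+1}=\bigcup_{n\ge1}\Gamma_{\xi,n}$ (a disjoint union); for limit $\xi$, $\Gamma_\xi=\bigcup_{\zeta<\xi}(\omega^\zeta+\Gamma_{\zeta+1})$ (a disjoint union). Each $t\in\Gamma_{\xi,n}$ is uniquely of the form $(\omega^\xi(n-1)+t_1)^\frown\cdots^\frown(\omega^\xi(n-m)+t_m)$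 with $1\leqslant m\leqslant n$, $t_i\in\Gamma_\xi$, and $t_i\in MAX(\Gamma_\xi)$ for $i<m$; put $\iota_{\xi,n}(t)=t_m\in\Gamma_\xi$. Define $\mathbb{P}_\xi:\Gamma_\xi\to[0,1]$ by $\mathbb{P}_0((0))=1$; $\mathbb{P}_{\xi+1}(t)=\frac1n\mathbb{P}_\xi(\iota_{\xi,n}(t))$ for $t\in\Gamma_{\xi,n}$; for limit $\xi$, $\mathbb{P}_\xi(\omega^\zeta+t')=\mathbb{P}_{\zeta+1}(t')$ for $\zeta<\xi$, $t'\in\Gamma_{\zeta+1}$. $\theta:\Gamma_\xi\to\Gamma_\xi$ is monotone if $s\prec t$ implies $\theta(s)\prec\theta(t)$. For $\varepsilon\in\mathbb{R}$, $f:\Gamma_\xi\to\mathbb{R}$ is $\varepsilon$-large if for any $\delta>0$ there exists a monotone $\theta:\Gamma_\xi\to\Gamma_\xi$ such that $f(\theta(t))\geqslant\varepsilon-\delta$ for all $t\in\Gamma_\xi$. *)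

(* Defs.v *)
From HB Require Import structures.
From mathcomp Require Import all_boot all_order all_algebra.
From mathcomp Require Import boolp classical_sets fsbigop reals ereal.

Set Implicit Arguments.
Unset Strict Implicit.
Unset Printing Implicit Defensive.

Import Order.TTheory GRing.Theory Num.Theory.
Local Open Scope classical_set_scope.
Local Open Scope quotient_scope.

(* The ordinals (of a universe) are the quotient of the following trees:
   [Node f] stands for the least ordinal greater than all the [f i]. *)
Inductive preord : Type := Node (I : Type) of I -> preord.

HB.instance Definition _ := gen_eqMixin preord.
HB.instance Definition _ := gen_choiceMixin preord.

Fixpoint ple (x y : preord) : Prop :=
  match x, y with
  | Node _ f, Node _ g => forall i, exists j, ple (f i) (g j)
  end.

Lemma ple_refl x : ple x x.
Proof. by elim: x => I f IH /= i; exists i; apply: IH. Qed.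

Lemma ple_trans y x z : ple x y -> ple y z -> ple x z.
Proof.
elim: y x z => J g IH [I f] [K h] /= xy yz i.
have [j fg] := xy i; have [k gh] := yz j.
by exists k; apply: IH fg gh.
Qed.

Definition pzero : preord := Node (fun v : void => match v with end).
Definition psucc (x : preord) : preord := Node (fun _ : unit => x).

Lemma ple_nodel I (f : I -> preord) y :
  ple (Node f) y <-> forall i, ple (psucc (f i)) y.
Proof.
case: y => J g; split=> [h i _|h i]; first exact: h i.
exact: h i tt.
Qed.

Lemma ple_psuccl x J (g : J -> preord) :
  ple (psucc x) (Node g) <-> exists j, ple x (g j).
Proof. by split=> [/(_ tt)|h _]. Qed.

Lemma ple_or_psucc x y : ple x y \/ ple (psucc y) x.
Proof.
elim: x y => I f IH y.
have [|/existsNP[i fi]] := pselect (forall i, ple (psucc (f i)) y).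
  by move=> h; left; apply/ple_nodel.
right; apply/ple_psuccl; exists i; case: y fi => J g fi.
apply/ple_nodel => j; case: (IH i (g j)) => // fg.
by case: fi; apply/ple_psuccl; exists j.
Qed.

Lemma ple_psucc x : ple x (psucc x).
Proof.
elim: x => I f IH; apply/ple_nodel => i; apply/ple_psuccl; exists tt.
by apply: ple_trans (IH i) _; apply/ple_psuccl; exists i; apply: ple_refl.
Qed.

Definition peq (x y : preord) : bool := `[< ple x y /\ ple y x >].

Lemma peq_refl : reflexive peq.
Proof. by move=> x; apply/asboolP; split; apply: ple_refl. Qed.

Lemma peq_sym : symmetric peq.
Proof. by move=> x y; apply/asboolP/asboolP => -[]. Qed.

Lemma peq_trans : transitive peq.
Proof.
move=> y x z /asboolP[xy yx] /asboolP[yz zy]; apply/asboolP.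
by split; [apply: ple_trans xy yz | apply: ple_trans zy yx].
Qed.

Canonical peq_equiv := EquivRel peq peq_refl peq_sym peq_trans.

Definition Ord := {eq_quot peq}.
HB.instance Definition _ := Choice.on Ord.
HB.instance Definition _ := EqQuotient.on Ord.

Definition ole (x y : Ord) : bool := `[< ple (repr x) (repr y) >].

Lemma piP_ple x : ple (repr (\pi_Ord x)) x /\ ple x (repr (\pi_Ord x)).
Proof.
have /eqmodP/asboolP : repr (\pi_Ord x) = x %[mod Ord] by rewrite reprK.
by [].
Qed.

Lemma ole_pi x y : ole (\pi_Ord x) (\pi_Ord y) <-> ple x y.
Proof.
have [x1 x2] := piP_ple x; have [y1 y2] := piP_ple y.
split=> [/asboolP xy|xy].
  exact: ple_trans x2 (ple_trans xy y1).
apply/asboolP; exact: ple_trans x1 (ple_trans xy y2).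
Qed.

Lemma ole_anti : antisymmetric ole.
Proof.
move=> x y /andP[/asboolP xy /asboolP yx].
by rewrite -[x]reprK -[y]reprK; apply/eqmodP/asboolP.
Qed.

Lemma ole_trans : transitive ole.
Proof.
move=> y x z /asboolP xy /asboolP yz; apply/asboolP; exact: ple_trans xy yz.
Qed.

Lemma ole_total : total ole.
Proof.
move=> x y; case: (ple_or_psucc (repr x) (repr y)) => [xy|yx]; apply/orP.
  by left; apply/asboolP.
by right; apply/asboolP; apply: ple_trans yx; apply: ple_psucc.
Qed.

Fact ord_display : Order.disp_t. Proof. exact: (Order.Disp tt tt). Qed.

HB.instance Definition _ :=
  @Order.isOrder.Build ord_display Ord ole _ _ _
    (fun _ _ => erefl) (fun _ _ => erefl) (fun _ _ => erefl)
    ole_anti ole_trans ole_total.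

Local Arguments ple : simpl never.

Lemma ole_piP x y : (\pi_Ord x <= \pi_Ord y)%O <-> ple x y.
Proof. exact: ole_pi. Qed.

Lemma psucc_irr x : ~ ple (psucc x) x.
Proof.
elim: x => I f IH /ple_psuccl[i fi]; apply: (IH i).
by apply: ple_trans fi; apply/ple_psuccl; exists i; apply: ple_refl.
Qed.

Lemma olt_piP x y : (\pi_Ord x < \pi_Ord y)%O <-> ple (psucc x) y.
Proof.
rewrite ltNge; split=> [/negP yx|xy].
  by case: (ple_or_psucc y x) => // /ole_piP.
apply/negP => /ole_piP yx; apply: (@psucc_irr x); exact: ple_trans xy yx.
Qed.

Lemma Ord_wf : well_founded (fun x y : Ord => (x < y)%O).
Proof.
move=> x; rewrite -[x]reprK; move: {x}(repr x) (ple_refl (repr x)) => x.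
move: {1 3}x => y; elim: x y => I f IH y yf; constructor => z.
rewrite -[z]reprK => /olt_piP zy.
have /ple_psuccl[i] := ple_trans zy yf; exact: IH.
Qed.

Lemma Ord_ind (P : Ord -> Prop) :
  (forall x, (forall y, (y < x)%O -> P y) -> P x) -> forall x, P x.
Proof. by move=> H; apply: (well_founded_ind Ord_wf). Qed.

Definition ozero : Ord := \pi_Ord pzero.
Definition osucc (x : Ord) : Ord := \pi_Ord (psucc (repr x)).

Lemma le0o x : (ozero <= x)%O.
Proof. by rewrite -[x]reprK; apply/ole_piP; case: (repr x) => J g []. Qed.

Lemma lt_osucc x y : (x < osucc y)%O = (x <= y)%O.
Proof.
rewrite -[x]reprK -[y in RHS]reprK; apply/idP/idP.
  by move=> /olt_piP/ple_psuccl[_ ?]; apply/ole_piP.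
by move=> /ole_piP ?; apply/olt_piP/ple_psuccl; exists tt.
Qed.

Lemma osucc_le x y : (osucc x <= y)%O = (x < y)%O.
Proof. by rewrite leNgt lt_osucc -ltNge. Qed.

Lemma osucc_gt x : (x < osucc x)%O.
Proof. by rewrite lt_osucc. Qed.

Lemma osucc_inj : injective osucc.
Proof.
move=> x y e; apply/eqP.
by rewrite eq_le -!lt_osucc e osucc_gt -e osucc_gt.
Qed.

Definition olimit (x : Ord) : Prop := x <> ozero /\ forall y, x <> osucc y.

Lemma olimit_succ x y : olimit x -> (y < x)%O -> (osucc y < x)%O.
Proof.
move=> [_ xS] yx; rewrite lt_neqAle osucc_le yx andbT.
by apply/eqP => /esym; apply: xS.
Qed.

Lemma ord_cases x : [\/ x = ozero, exists y, x = osucc y | olimit x].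
Proof.
have [|x0] := pselect (x = ozero); first by constructor 1.
have [|xS] := pselect (exists y, x = osucc y); first by constructor 2.
by constructor 3; split=> // y xy; apply: xS; exists y.
Qed.

Definition pidx (x : preord) : Type := match x with Node J _ => J end.
Definition pbr (x : preord) : pidx x -> preord := 
  match x with Node _ f => f end.

Fixpoint padd (x y : preord) {struct y} : preord :=
  let: Node J g := y in
  Node (fun k : pidx x + J =>
          match k with inl i => pbr i | inr j => padd x (g j) end).

Definition pjoin (I : Type) (h : I -> preord) : preord :=
  Node (fun p : {i & pidx (h i)} => pbr (projT2 p)).

(* omega^x is the supremum of 1 and of all the omega^y n, for y < x and n : nat. *)
Fixpoint pexp (x : preord) : preord :=
  let: Node J g := x in
  pjoin (fun k : option (J * nat) =>
           if k is Some (j, n) then iter n (padd ^~ (pexp (g j))) pzero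
           else psucc pzero).

Definition oadd (x y : Ord) : Ord := \pi_Ord (padd (repr x) (repr y)).
Definition omuln (x : Ord) (n : nat) : Ord := iter n (oadd ^~ x) ozero.
Definition oexp (x : Ord) : Ord := \pi_Ord (pexp (repr x)).

Lemma plt_add1 x y z : ple (psucc z) x -> ple (psucc z) (padd x y).
Proof.
case: x => I f /ple_psuccl[i zi]; case: y => J g.
by apply/ple_psuccl; exists (inl i).
Qed.

Lemma plt_pbr x i : ple (psucc (@pbr x i)) x.
Proof. by case: x i => I f i; apply/ple_psuccl; exists i; apply: ple_refl. Qed.

Lemma padd_ler x y y' : ple y y' -> ple (padd x y) (padd x y').
Proof.
elim: y y' => J g IH [K h] gh; apply/ple_nodel => -[i|j] /=.
  exact/(plt_add1 (Node h))/plt_pbr.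
by have [k gk] := gh j; apply/ple_psuccl; exists (inr k); apply: IH.
Qed.

Lemma padd_lel x x' y : ple x x' -> ple (padd x y) (padd x' y).
Proof.
move=> xx'; elim: y => J g IH; apply/ple_nodel => -[i|j] /=.
  apply: (plt_add1 (Node g)); apply: ple_trans xx'; exact: plt_pbr.
by apply/ple_psuccl; exists (inr j); apply: IH.
Qed.

Lemma padd_le x y z :
  ple (padd x y) z <->
  ple x z /\ forall w, ple (psucc w) y -> ple (psucc (padd x w)) z.
Proof.
case: y => J g; split=> [h|[xz h]]; last first.
  apply/ple_nodel => -[i|j] /=.
    by apply: ple_trans xz; apply: plt_pbr.
  by apply: h; apply/ple_psuccl; exists j; apply: ple_refl.
split.
  apply: ple_trans h; case: (x) => I f; apply/ple_nodel => i.
  by apply/ple_psuccl; exists (inl i); apply: ple_refl.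
move=> w /ple_psuccl[j wj]; apply: ple_trans h.
by apply/ple_psuccl; exists (inr j); apply: padd_ler.
Qed.

Lemma oadd_pi x y : oadd (\pi_Ord x) (\pi_Ord y) = \pi_Ord (padd x y).
Proof.
have [x1 x2] := piP_ple x; have [y1 y2] := piP_ple y.
apply/eqmodP/asboolP; split.
  exact: ple_trans (padd_lel _ x1) (padd_ler _ y1).
exact: ple_trans (padd_lel _ x2) (padd_ler _ y2).
Qed.

Lemma oadd_leP x y z : (oadd x y <= z)%O <->
  (x <= z)%O /\ forall w, (w < y)%O -> (oadd x w < z)%O.
Proof.
rewrite -[x]reprK -[y]reprK -[z]reprK oadd_pi; split.
  move=> /ole_piP/padd_le[xz h]; split; first exact/ole_piP.
  by move=> w; rewrite -[w]reprK oadd_pi => /olt_piP/h/olt_piP.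
move=> [/ole_piP xz h]; apply/ole_piP/padd_le; split=> // w /olt_piP/h.
by rewrite oadd_pi => /olt_piP.
Qed.


Lemma pjoin_le I (h : I -> preord) z : ple (pjoin h) z <-> forall i, ple (h i) z.
Proof.
split=> [hz i|hz].
  apply: ple_trans hz.
  have : forall k : pidx (h i), ple (psucc (pbr k)) (pjoin h).
    move=> k; apply/ple_psuccl; exists (existT (fun i => pidx (h i)) i k) => /=.
    exact: ple_refl.
  by move: (pjoin h) => w; case: (h i) => J g H; apply/ple_nodel.
apply/ple_nodel => -[i k] /=; apply: ple_trans (hz i); exact: plt_pbr.
Qed.

Lemma pmuln_le x y n :
  ple x y -> ple (iter n (padd ^~ x) pzero) (iter n (padd ^~ y) pzero).
Proof.
move=> xy; elim: n => [|n IH]; first exact: ple_refl.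
exact: ple_trans (padd_lel _ IH) (padd_ler _ xy).
Qed.

Lemma pexp_mono x y : ple x y -> ple (pexp x) (pexp y).
Proof.
elim: x y => J g IH [K h] gh; apply/pjoin_le => -[[j n]|]; last first.
  rewrite [pexp _]/=; set H := (H in pjoin H).
  exact: (pjoin_le H _).1 (ple_refl _) None.
have [k gk] := gh j.
apply: ple_trans (pmuln_le n (IH _ _ gk)) _.
rewrite [pexp (Node h)]/=; set H := (H in pjoin H).
exact: (pjoin_le H _).1 (ple_refl _) (Some (k, n)).
Qed.

Lemma pexp_le x z : ple (pexp x) z <->
  ple (psucc pzero) z /\
  forall w, ple (psucc w) x -> forall n, ple (iter n (padd ^~ (pexp w)) pzero) z.
Proof.
case: x => J g; rewrite [pexp _]/=; split=> [/pjoin_le h|[h0 h]].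
  split; first exact: (h None).
  move=> w /ple_psuccl[j wj] n; apply: ple_trans (h (Some (j, n))).
  exact/pmuln_le/pexp_mono.
apply/pjoin_le => -[[j n]|//]; apply: h.
by apply/ple_psuccl; exists j; apply: ple_refl.
Qed.

Lemma omuln_pi x n :
  omuln (\pi_Ord x) n = \pi_Ord (iter n (padd ^~ x) pzero).
Proof. by elim: n => // n; rewrite /omuln /= => ->; rewrite oadd_pi. Qed.

Lemma osucc_pi x : osucc (\pi_Ord x) = \pi_Ord (psucc x).
Proof.
have [x1 x2] := piP_ple x.
by apply/eqmodP/asboolP; split; apply/ple_psuccl; exists tt.
Qed.

Lemma oexp_pi x : oexp (\pi_Ord x) = \pi_Ord (pexp x).
Proof.
have [x1 x2] := piP_ple x.
by apply/eqmodP/asboolP; split; apply: pexp_mono.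
Qed.

Lemma oexp_leP x z : (oexp x <= z)%O <->
  (ozero < z)%O /\
  forall y, (y < x)%O -> forall n, (omuln (oexp y) n <= z)%O.
Proof.
rewrite -[x]reprK -[z]reprK oexp_pi; split.
  move=> /ole_piP/pexp_le[z0 h]; split; first exact/olt_piP.
  move=> y; rewrite -[y]reprK => /olt_piP/h{}h n.
  by rewrite oexp_pi omuln_pi; apply/ole_piP/h.
move=> [/olt_piP z0 h]; apply/ole_piP/pexp_le; split=> // w /olt_piP/h{}h n.
by apply/ole_piP; rewrite -omuln_pi -oexp_pi.
Qed.


Lemma oadd0 x : oadd x ozero = x.
Proof.
apply/eqP; rewrite eq_le; apply/andP; split; last first.
  by have [] := (oadd_leP x ozero _).1 (lexx _).
by apply/oadd_leP; split=> // w; rewrite ltNge le0o.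
Qed.

Lemma oadd_ltr x y z : (y < z)%O -> (oadd x y < oadd x z)%O.
Proof. by have [_] := (oadd_leP x z _).1 (lexx _); apply. Qed.

Lemma oadd_lt2 x y z : (oadd x y < oadd x z)%O = (y < z)%O.
Proof.
apply/idP/idP; last exact: oadd_ltr.
by rewrite !ltNge; apply: contra; rewrite !le_eqVlt => /orP[/eqP->|/oadd_ltr->];
  rewrite ?eqxx ?orbT.
Qed.

Lemma oadd_inj x : injective (oadd x).
Proof.
move=> y z e; apply/eqP; by rewrite eq_le !leNgt -(oadd_lt2 x y z) -(oadd_lt2 x z y) e ltxx.
Qed.

Lemma oadd_gel x y : (x <= oadd x y)%O.
Proof. by have [] := (oadd_leP x y _).1 (lexx _). Qed.

Lemma oaddS x y : oadd x (osucc y) = osucc (oadd x y).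
Proof.
apply/eqP; rewrite eq_le; apply/andP; split; last first.
  by rewrite osucc_le oadd_lt2 osucc_gt.
apply/oadd_leP; split=> [|w]; first exact: le_trans (oadd_gel _ _) (ltW (osucc_gt _)).
by rewrite !lt_osucc => wy; rewrite leNgt oadd_lt2 -leNgt.
Qed.

Lemma omuln1 x : omuln x 1 = oadd ozero x. Proof. by []. Qed.

Lemma add0o x : oadd ozero x = x.
Proof.
elim/Ord_ind: x => x IH; apply/eqP; rewrite eq_le; apply/andP; split.
  by apply/oadd_leP; split=> [|w wx]; rewrite ?le0o // IH.
rewrite leNgt; apply/negP => h; have := IH _ h.
by move=> /oadd_inj e; rewrite e ltxx in h.
Qed.

Lemma oaddA x y z : oadd x (oadd y z) = oadd (oadd x y) z.
Proof.
elim/Ord_ind: z => z IH; apply/eqP; rewrite eq_le; apply/andP; split.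
  apply/oadd_leP; split; first exact: le_trans (oadd_gel _ _) (oadd_gel _ _).
  move=> w wyz; have [wy|yw] := ltP w y.
    by apply: lt_le_trans (oadd_gel _ _); apply: oadd_ltr.
  rewrite ltNge; apply/negP => /oadd_leP[h1 h2].
  have : (oadd y z <= w)%O.
    apply/oadd_leP; split=> // v vz.
    by rewrite -(oadd_lt2 x) IH //; exact: h2.
  by rewrite leNgt wyz.
apply/oadd_leP; split=> [|w wz].
  by rewrite leNgt oadd_lt2 -leNgt oadd_gel.
by rewrite -IH // !oadd_lt2.
Qed.

Lemma oexp_gt0 x : (ozero < oexp x)%O.
Proof. by have [] := (oexp_leP x _).1 (lexx _). Qed.

Lemma oexp0 : oexp ozero = osucc ozero.
Proof.
apply/eqP; rewrite eq_le osucc_le oexp_gt0 andbT; apply/oexp_leP.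
by split=> [|y]; [exact: osucc_gt | rewrite ltNge le0o].
Qed.

Lemma omuln_ltS x n : (ozero < x)%O -> (omuln x n < omuln x n.+1)%O.
Proof. by move=> x0; rewrite [X in (_ < X)%O]/= -[X in (X < _)%O]oadd0 oadd_lt2. Qed.

Lemma omuln_le x m n : (m <= n)%N -> (omuln x m <= omuln x n)%O.
Proof.
by elim: n => [|n IH]; rewrite leq_eqVlt => /orP[/eqP->//|//];
   rewrite ltnS => /IH/le_trans -> //; apply: oadd_gel.
Qed.

Lemma omuln_oexp_lt x y n : (x < y)%O -> (omuln (oexp x) n < oexp y)%O.
Proof.
move=> xy; apply: lt_le_trans (omuln_ltS n (oexp_gt0 x)) _.
have [_ h] := (oexp_leP y _).1 (lexx _); exact: h.
Qed.

Lemma oexpS_lt x y :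
  (y < oexp (osucc x))%O -> exists n, (y < omuln (oexp x) n)%O.
Proof.
move=> yx; apply: contrapT => /forallNP h; move: yx.
rewrite ltNge => /negP; apply; apply/oexp_leP.
have H n : (omuln (oexp x) n <= y)%O by rewrite leNgt; apply/negP.
split=> [|z]; first by apply: lt_le_trans (H 1%N); rewrite omuln1 add0o oexp_gt0.
rewrite lt_osucc le_eqVlt => /orP[/eqP->//|zx n].
apply: le_trans (H 1%N); rewrite omuln1 add0o; exact/ltW/omuln_oexp_lt.
Qed.

Lemma oexp_lt x y : (x < y)%O -> (oexp x < oexp y)%O.
Proof. by move=> /(omuln_oexp_lt 1); rewrite omuln1 add0o. Qed.

Lemma omulnSl x n : omuln x n.+1 = oadd x (omuln x n).
Proof.
elim: n => [|n IH]; first by rewrite oadd0 omuln1 add0o.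
by rewrite -[LHS]/(oadd (omuln x n.+1) x) [in LHS]IH; apply/esym/oaddA.
Qed.

Definition oshift (x : Ord) (s : seq Ord) : seq Ord := map (oadd x) s.

Definition MAX (S : set (seq Ord)) : set (seq Ord) :=
  [set s | S s /\ forall t, S t -> prefix s t -> t = s].

(* For w = omega^xi and G = Gamma_xi, [Gamman_step w G n] is Gamma_{xi,n}, which
   the mathematics only defines for n >= 1; the value at n = 0 is a dummy one. *)
Fixpoint Gamman_step (w : Ord) (G : set (seq Ord)) (n : nat) : set (seq Ord) :=
  match n with
  | 0 => set0
  | 1 => G
  | m.+1 => oshift (omuln w m) @` G `|`
      [set t ++ u | t in MAX (oshift (omuln w m) @` G) & u in Gamman_step w G m]
  end.

Definition Gamma_step (xi : Ord)
    (rec : forall zeta, (zeta < xi)%O -> set (seq Ord)) : set (seq Ord) :=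
  [set t | [\/ xi = ozero /\ t = [:: ozero],
    exists zeta (lt_zeta : (zeta < xi)%O), xi = osucc zeta /\
      exists2 n, (0 < n)%N & Gamman_step (oexp zeta) (rec zeta lt_zeta) n t
  | olimit xi /\ exists zeta (lt_zeta : (osucc zeta < xi)%O),
      (oshift (oexp zeta) @` rec (osucc zeta) lt_zeta) t]].

Definition Gamma : Ord -> set (seq Ord) :=
  Fix Ord_wf (fun _ => set (seq Ord)) Gamma_step.

Definition Gamman (xi : Ord) (n : nat) : set (seq Ord) :=
  Gamman_step (oexp xi) (Gamma xi) n.

Lemma GammaE xi : Gamma xi = @Gamma_step xi (fun zeta _ => Gamma zeta).
Proof.
rewrite /Gamma Fix_eq // => x f g fg; congr Gamma_step.
by apply/functional_extensionality_dep => y; apply/functional_extensionality_dep.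
Qed.

Lemma olimit_not0 : ~ olimit ozero. Proof. by case. Qed.

Lemma osucc_neq0 x : osucc x <> ozero.
Proof. by move=> e; have := osucc_gt x; rewrite e ltNge le0o. Qed.

Lemma Gamma0 : Gamma ozero = [set [:: ozero]].
Proof.
rewrite GammaE; apply/seteqP; split=> t.
  move=> [[]//|[z [h _]]|[/olimit_not0]//].
  by move: h; rewrite ltNge le0o.
by move=> ->; constructor 1.
Qed.

Lemma GammaS xi : Gamma (osucc xi) = \bigcup_(n in [set n | (0 < n)%N]) Gamman xi n.
Proof.
rewrite GammaE; apply/seteqP; split=> t.
  move=> [[/osucc_neq0//]|[z [h [/osucc_inj <- [n n0 tn]]]]|[[_ /(_ xi)//]]].
  by exists n.
by move=> [n n0 tn]; constructor 2; exists xi, (osucc_gt xi); split=> //; exists n.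
Qed.

Lemma Gamma_lim xi : olimit xi -> Gamma xi =
  \bigcup_(zeta in [set zeta | (zeta < xi)%O])
    oshift (oexp zeta) @` Gamma (osucc zeta).
Proof.
move=> lxi; rewrite GammaE; apply/seteqP; split=> t.
  move=> [[e]|[z [h [e]]]|[_ [z [h tz]]]].
  - by move: lxi; rewrite e => /olimit_not0.
  - by case: lxi => _ /(_ z).
  - by exists z => //=; apply: lt_trans h; apply: osucc_gt.
move=> [z zxi tz]; constructor 3; split=> //.
by exists z, (olimit_succ lxi zxi).
Qed.

Lemma Gamman1 xi : Gamman xi 1 = Gamma xi. Proof. by []. Qed.

Lemma GammanS xi n : (0 < n)%N ->
  Gamman xi n.+1 =
  oshift (omuln (oexp xi) n) @` Gamma xi `|`
  [set t ++ u | t in MAX (oshift (omuln (oexp xi) n) @` Gamma xi) & u in Gamman xi n].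
Proof. by case: n. Qed.

(* [ts] is the sequence (t_1, ..., t_m) with
   t = (omega^xi (n - 1) + t_1) ++ ... ++ (omega^xi (n - m) + t_m). *)
Definition Gamman_decomp (xi : Ord) (n : nat) (t : seq Ord)
    (ts : seq (seq Ord)) : Prop :=
  [/\ (1 <= size ts <= n)%N,
      forall i, (i < size ts)%N -> Gamma xi (nth [::] ts i),
      forall i, (i < (size ts).-1)%N -> MAX (Gamma xi) (nth [::] ts i)
    & t = flatten [seq oshift (omuln (oexp xi) (n - i.+1)) (nth [::] ts i)
                  | i <- iota 0 (size ts)]].

(* iota_{xi,n}(t) = t_m *)
Definition tail_block (xi : Ord) (n : nat) (t : seq Ord) : seq Ord :=
  xget [::] [set u | exists2 ts, Gamman_decomp xi n t ts & u = last [::] ts].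

Inductive PP_graph (R : realType) : Ord -> seq Ord -> R -> Prop :=
| PP_graph0 : PP_graph ozero [:: ozero] 1%R
| PP_graphS xi n t p : (0 < n)%N -> Gamman xi n t ->
    PP_graph xi (tail_block xi n t) p ->
    PP_graph (osucc xi) t (n%:R^-1 * p)%R
| PP_graph_lim xi zeta t p : olimit xi -> (zeta < xi)%O ->
    Gamma (osucc zeta) t -> PP_graph (osucc zeta) t p ->
    PP_graph xi (oshift (oexp zeta) t) p.

(* The graph is functional and total on [Gamma xi] (PP_graph_fun, PP_graph_ex);
   [PP R xi t] is 0 when t is not in [Gamma xi]. *)
Definition PP (R : realType) (xi : Ord) (t : seq Ord) : R :=
  xget 0%R [set p | PP_graph xi t p].

Lemma oshift0 s : oshift ozero s = s.
Proof. by rewrite /oshift (eq_map add0o) map_id. Qed.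

Lemma Gamman_bound xi n t :
  (forall s, Gamma xi s -> s != [::] /\ forall x, x \in s -> (x < oexp xi)%O) ->
  Gamman xi n t ->
  [/\ t != [::], forall x, x \in t -> (x < omuln (oexp xi) n)%O
    & exists2 x, x \in t & (omuln (oexp xi) n.-1 <= x)%O].
Proof.
move=> B; elim: n t => [//|n IH] t.
have Bs m s : Gamma xi s -> [/\ oshift (omuln (oexp xi) m) s != [::],
    forall x, x \in oshift (omuln (oexp xi) m) s -> (x < omuln (oexp xi) m.+1)%O
    & exists2 x, x \in oshift (omuln (oexp xi) m) s & (omuln (oexp xi) m <= x)%O].
  move=> /B[s0 sx]; split; first by case: s s0 {sx}.
    by move=> _ /mapP[x /sx xs ->]; apply: oadd_ltr.
  case: s s0 {sx} => // x s _; exists (oadd (omuln (oexp xi) m) x).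
    by rewrite inE eqxx.
  exact: oadd_gel.
have [->|n0] := posnP n.
  rewrite Gamman1 => /(Bs 0%N).
  by rewrite oshift0.
rewrite GammanS // => -[[s /(Bs n) h <-//]|[_ [[s /(Bs n)[h1 h2 [x h3 h4]] <-] _] [u /IH[k1 k2 k3]] <-]].
split.
- by case: oshift h1.
- move=> y; rewrite mem_cat => /orP[/h2//|/k2 ylt].
  apply: lt_le_trans ylt _; exact: omuln_le.
- by exists x => //; rewrite mem_cat h3.
Qed.

Lemma Gamma_bound xi s :
  Gamma xi s -> s != [::] /\ forall x, x \in s -> (x < oexp xi)%O.
Proof.
elim/Ord_ind: xi s => xi IH s; case: (ord_cases xi) => [->|[z e]|lxi].
- rewrite Gamma0 => ->; split=> // x; rewrite inE => /eqP ->.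
  exact: oexp_gt0.
- rewrite e GammaS => -[n n0] /(Gamman_bound (IH z _)); rewrite e osucc_gt.
  move=> /(_ isT)[h1 h2 _]; split=> // x /h2 /lt_trans; apply.
  exact/omuln_oexp_lt/osucc_gt.
- rewrite Gamma_lim // => -[z zxi [t /IH h] <-].
  have [h1 h2] := h (olimit_succ lxi zxi); split; first by case: (t) h1.
  move=> _ /mapP[x /h2 xt ->].
  have [n xn] := oexpS_lt xt.
  apply: lt_trans (omuln_oexp_lt n.+1 zxi).
  by rewrite omulnSl oadd_lt2.
Qed.

Lemma Gamman_lt xi n t x :
  Gamman xi n t -> x \in t -> (x < omuln (oexp xi) n)%O.
Proof. by move=> /(Gamman_bound (@Gamma_bound xi))[_ h _]; apply: h. Qed.

Lemma Gamman_disj xi m n t : Gamman xi m t -> Gamman xi n t -> m = n.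
Proof.
wlog mn : m n / (m <= n)%N.
  move=> H; case/orP: (leq_total m n) => h; first exact: H.
  by move=> *; apply/esym/H.
move=> tm /(Gamman_bound (@Gamma_bound xi))[_ _ [x xt nx]].
have xm := Gamman_lt tm xt.
apply/eqP; rewrite eqn_leq mn /= leqNgt; apply/negP => lt_mn.
suff : (x < omuln (oexp xi) n.-1)%O by rewrite ltNge nx.
apply: lt_le_trans xm (omuln_le _ _).
by case: n lt_mn {mn nx}.
Qed.

Lemma Gamma_lim_disj xi y z s t : (y < xi)%O -> (z < xi)%O ->
  Gamma (osucc y) s -> Gamma (osucc z) t ->
  oshift (oexp y) s = oshift (oexp z) t -> y = z /\ s = t.
Proof.
wlog yz : y z s t / (y <= z)%O.
  move=> H; case/orP: (le_total y z) => h; first exact: H.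
  by move=> ? ? ? ? /esym e; have [] := H _ _ _ _ h _ _ _ _ e.
move=> _ _ /Gamma_bound[_ sB] /Gamma_bound[t0 _] e.
have yz' : y = z.
  apply/eqP; move: yz; rewrite le_eqVlt => /orP[//|yz].
  have [x xt] : exists x, x \in t by case: t t0 {e} => // x *; exists x; rewrite inE eqxx.
  have : oadd (oexp z) x \in oshift (oexp y) s by rewrite e map_f.
  case/mapP=> w /sB /oexpS_lt[n wn] e'.
  have := oadd_gel (oexp z) x; rewrite e' leNgt.
  by rewrite (lt_trans _ (omuln_oexp_lt n.+1 yz)) // omulnSl oadd_lt2.
split=> //; rewrite yz' in e; apply: inj_map e; exact: oadd_inj.
Qed.

Lemma MAX_oshift x (S : set (seq Ord)) s :
  MAX (oshift x @` S) (oshift x s) -> MAX S s.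
Proof.
have inj : injective (oshift x) by apply/inj_map/oadd_inj.
move=> [[s' Ss' /inj <-] h]; split=> // t St /prefixP[u e].
by apply/inj/h; [exists t | rewrite e /oshift map_cat prefix_prefix].
Qed.

Lemma Gamman_decomp_cons xi n t a ts :
  Gamman_decomp xi n.+1 t (a :: ts) <->
  Gamma xi a /\
  ((ts = [::] /\ t = oshift (omuln (oexp xi) n) a) \/
   (MAX (Gamma xi) a /\ exists2 u, Gamman_decomp xi n u ts &
      t = oshift (omuln (oexp xi) n) a ++ u)).
Proof.
have E : flatten [seq oshift (omuln (oexp xi) (n.+1 - i.+1)) (nth [::] (a :: ts) i)
   | i <- iota 0 (size (a :: ts))] = oshift (omuln (oexp xi) n) a ++
   flatten [seq oshift (omuln (oexp xi) (n - i.+1)) (nth [::] ts i)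
   | i <- iota 0 (size ts)].
  rewrite /= subSS subn0 (iotaDl 1 0) -map_comp; congr (_ ++ flatten _).
split.
  move=> [h1 h2 h3 ->]; split; first exact: (h2 0%N).
  rewrite E; case: ts h1 h2 h3 {E} => [|b ts] h1 h2 h3; first by left; rewrite /= cats0.
  right; split; first exact: (h3 0%N).
  eexists; last by [].
  split=> // i ib; [exact: (h2 i.+1)|exact: (h3 i.+1)].
move=> [Ga [[-> ->]|[Ma [u [h1 h2 h3 ->] ->]]]].
  by split=> //= [[]//|]; rewrite subSS subn0 cats0.
split; rewrite ?E //; first by case/andP: h1.
  by case=> [|i] //=; rewrite ltnS; apply: h2.
case=> [|i] //= ilt; apply: h3.
by case: (size ts) ilt.
Qed.

Lemma Gamman_decomp_ex xi n t :
  Gamman xi n t -> exists ts, Gamman_decomp xi n t ts.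
Proof.
elim: n t => [//|n IH] t; have [->|n0] := posnP n.
  rewrite Gamman1 => tG; exists [:: t]; apply/Gamman_decomp_cons; split=> //.
  by left; split=> //; rewrite oshift0.
rewrite GammanS // => -[[s sG <-]|[_ [[s sG <-] sM] [u /IH[ts uts]] <-]].
  by exists [:: s]; apply/Gamman_decomp_cons; split=> //; left.
exists (s :: ts); apply/Gamman_decomp_cons; split=> //; right.
split; last by exists u.
by apply: (@MAX_oshift (omuln (oexp xi) n)); split=> //; exists s.
Qed.

Lemma Gamman_decomp_lt xi n t ts x :
  Gamman_decomp xi n t ts -> x \in t -> (x < omuln (oexp xi) n)%O.
Proof.
elim: n t ts x => [|n IH] t [|a ts] x; [by case | by case | by case |].
move=> /Gamman_decomp_cons[Ga].
have La : x \in oshift (omuln (oexp xi) n) a -> (x < omuln (oexp xi) n.+1)%O.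
  by case/mapP => y /(Gamma_bound Ga).2 yx ->; apply: oadd_ltr.
move=> [[_ ->]//|[_ [u uts ->]]]; rewrite mem_cat => /orP[//|].
by move=> /(IH _ _ _ uts)/lt_le_trans; apply; apply: omuln_le.
Qed.

Lemma Gamman_decomp_uniq xi n t ts ts' :
  Gamman_decomp xi n t ts -> Gamman_decomp xi n t ts' -> ts = ts'.
Proof.
have inj x : injective (oshift x) by apply/inj_map/oadd_inj.
elim: n t ts ts' => [|n IH] t [|a ts] [|b ts'];
  [by case | by case | by case | by case | by case | by case | by move=> _ [] |].
set w := omuln (oexp xi) n.
have F c us : Gamman_decomp xi n.+1 t (c :: us) ->
    [seq x <- t | (w <= x)%O] = oshift w c /\
    ((us = [::] /\ [seq x <- t | (x < w)%O] = [::]) \/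
     Gamman_decomp xi n [seq x <- t | (x < w)%O] us).
  have F1 : [seq x <- oshift w c | (w <= x)%O] = oshift w c.
    by apply/all_filterP/allP => _ /mapP[x _ ->]; apply: oadd_gel.
  have F2 : [seq x <- oshift w c | (x < w)%O] = [::].
    apply/eqP; rewrite -[_ == _]negbK -has_filter; apply/hasPn => _ /mapP[x _ ->].
    by rewrite -leNgt oadd_gel.
  move=> /Gamman_decomp_cons[_ [[-> ->]|[_ [u uus ->]]]]; first by split=> //; left.
  have G1 : [seq x <- u | (w <= x)%O] = [::].
    apply/eqP; rewrite -[_ == _]negbK -has_filter; apply/hasPn => x /(Gamman_decomp_lt uus).
    by rewrite -ltNge.
  have G2 : [seq x <- u | (x < w)%O] = u.
    by apply/all_filterP/allP => x /(Gamman_decomp_lt uus).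
  by rewrite !filter_cat F1 F2 G1 G2 cats0; split=> //; right.
move=> /F[ea ha] /F[eb hb].
have -> : a = b by apply: (inj w); rewrite -ea -eb.
have N us : Gamman_decomp xi n [::] us -> False.
  case: n us {IH w F ea ha eb hb} => [|n] [|c us]; [by case|by case|by case|].
  move=> /Gamman_decomp_cons[/Gamma_bound[c0 _] h].
  by case: c c0 h => // x c _ [[]//|[_ []//]].
congr (_ :: _); case: ha hb => [[-> e]|ha] [[-> e']|hb] //.
- by case: (N ts'); rewrite -e.
- by case: (N ts); rewrite -e'.
- exact: IH ha hb.
Qed.

Lemma tail_blockE xi n t ts :
  Gamman_decomp xi n t ts -> tail_block xi n t = last [::] ts.
Proof.
move=> tts; apply: xget_unique; first by exists ts.
by move=> u [us tus ->]; rewrite (Gamman_decomp_uniq tus tts).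
Qed.

Lemma tail_block_Gamma xi n t : Gamman xi n t -> Gamma xi (tail_block xi n t).
Proof.
move=> /Gamman_decomp_ex[ts tts]; rewrite (tail_blockE tts).
by case: tts => /andP[ts0 _] h _ _; rewrite -nth_last; apply: h; rewrite prednK.
Qed.

Lemma PP_graph_ex (R : realType) xi t : Gamma xi t -> exists p : R, PP_graph xi t p.
Proof.
elim/Ord_ind: xi t => xi IH t; case: (ord_cases xi) => [->|[z e]|lxi].
- by rewrite Gamma0 => ->; exists 1%R; constructor.
- rewrite e GammaS => -[n n0 tn].
  have [|p hp] := IH z _ (tail_block z n t) (tail_block_Gamma tn).
    by rewrite e osucc_gt.
  by exists (n%:R^-1 * p)%R; apply: PP_graphS.
- rewrite Gamma_lim // => -[z zxi [s sz <-]].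
  have [p hp] := IH _ (olimit_succ lxi zxi) s sz.
  by exists p; apply: (PP_graph_lim lxi zxi).
Qed.

Lemma PP_graph_fun (R : realType) xi t (p q : R) : PP_graph xi t p -> PP_graph xi t q -> p = q.
Proof.
move=> H; elim: H q => {xi t p}.
- move=> q; move E : ozero => x H; case: H E => // [> _ _ _ /esym/osucc_neq0//|].
  by move=> > lx _ _ _ e; case: lx; rewrite e.
- move=> xi n t p n0 tn _ IH q; move E : (osucc xi) => x H; case: H tn IH E.
  + by move=> _ _ /osucc_neq0.
  + move=> xi' m s r m0 sm H tn IH /osucc_inj e; subst xi'.
    by have e := Gamman_disj tn sm; subst m; rewrite (IH _ H).
  + by move=> x' > lx _ _ _ _ _ e; case: lx => _ /(_ xi)/(_ (esym e)).
- move=> xi z t p lxi zxi tz _ IH q; move E : (oshift _ _) => s H.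
  case: H lxi zxi E.
  + by move=> /olimit_not0.
  + by move=> x' > _ _ _ [_ /(_ x')].
  + move=> xi' z' s' r _ z'xi s'z H _ zxi /(Gamma_lim_disj zxi z'xi tz s'z)[e1 e2].
    by subst; apply: IH.
Qed.

Lemma PPE (R : realType) xi t (p : R) : PP_graph xi t p -> PP R xi t = p.
Proof.
by move=> h; apply: xget_unique => // q hq; apply: PP_graph_fun hq h.
Qed.

Lemma PP_graphP (R : realType) xi t : Gamma xi t -> PP_graph xi t (PP R xi t).
Proof. by move=> /(PP_graph_ex R)[p hp]; rewrite (PPE hp). Qed.

Lemma PP0 (R : realType) : PP R ozero [:: ozero] = 1%R.
Proof. by apply: PPE; constructor. Qed.

Lemma PPS (R : realType) xi n t : (0 < n)%N -> Gamman xi n t ->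
  PP R (osucc xi) t = (n%:R^-1 * PP R xi (tail_block xi n t))%R.
Proof.
move=> n0 tn; apply: PPE; apply: PP_graphS => //.
exact/PP_graphP/tail_block_Gamma.
Qed.

Lemma PP_lim (R : realType) xi zeta t : olimit xi -> (zeta < xi)%O -> Gamma (osucc zeta) t ->
  PP R xi (oshift (oexp zeta) t) = PP R (osucc zeta) t.
Proof.
by move=> lxi zxi tz; apply: PPE; apply: (PP_graph_lim lxi zxi) => //; apply: PP_graphP.
Qed.

(* The strict initial segment relation; the large one is [prefix]. *)
Definition proper_prefix (s t : seq Ord) : bool := prefix s t && (s != t).

(* Functions with domain [Gamma xi] are represented by functions defined on all
   sequences, of which only the restriction to [Gamma xi] is used. *)
Definition Gamma_monotone (xi : Ord) (theta : seq Ord -> seq Ord) : Prop :=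
  (forall t, Gamma xi t -> Gamma xi (theta t)) /\
  (forall s t, Gamma xi s -> Gamma xi t ->
     proper_prefix s t -> proper_prefix (theta s) (theta t)).

Definition large (R : realType) (xi : Ord) (eps : R) (f : seq Ord -> R) : Prop :=
  forall delta : R, (0 < delta)%R ->
    exists2 theta, Gamma_monotone xi theta &
      forall t, Gamma xi t -> (eps - delta <= f (theta t))%R.

Definition bounded_on_Gamma (R : realType) (xi : Ord) (f : seq Ord -> R) : Prop :=
  exists M : R, forall t, Gamma xi t -> (`|f t| <= M)%R.

Definition branch_sum (R : realType) (xi : Ord) (eps : R) (f : seq Ord -> R)
    (t : seq Ord) : R :=
  (\sum_(s \in Gamma xi `&` [set s | prefix s t]) PP R xi s * (f s - eps))%R.

(* Main.v *)
(* If f_i is not eps_i-large, then Gamma_xi does not embed monotonically into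
   A_i = {f_i >= eps_i}, so that A_i has rank below omega^xi. Off A_i the terms
   of the i-th sum are nonpositive, so it suffices to find maximal branches on
   which P_xi gives every A_i arbitrarily small mass; this is done by induction
   on xi. At xi + 1, take Gamma_{xi,n} with n large and keep track of the rank
   omega^xi a_i + r_i of A_i beyond the blocks chosen so far. In the next block
   the elements of A_i of rank at least omega^xi a_i form a set of rank at most
   r_i < omega^xi, hence have small mass along a suitable branch of the block; if
   that branch meets other elements of A_i, then a_i drops, which happens
   boundedly often, and each block only weighs 1/n. A rank below omega^xi with
   xi a limit is below omega^(zeta + 1) for some zeta < xi. *)
Require Import Defs.
From mathcomp Require Import all_boot all_order all_algebra.
From mathcomp Require Import boolp classical_sets fsbigop reals ereal.
From mathcomp Require Import lra.

Import Order.TTheory GRing.Theory Num.Theory.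

Local Open Scope classical_set_scope.
Local Open Scope ring_scope.

(** * Ordinal arithmetic: subtraction, division, and powers at limits *)

Lemma ord_least (S : set Ord) :
  S !=set0 -> exists x, S x /\ forall y, S y -> (x <= y)%O.
Proof.
move=> [x Sx]; apply: contrapT => /forallNP h.
elim/Ord_ind: x Sx => x IH Sx; apply: (h x); split=> // y Sy.
by rewrite leNgt; apply/negP => /IH; apply.
Qed.

(** The witness is the least [z] with [y <= x + z], which exists because [y <= x + y]. Minimality
    puts every [x + w] with [w < z] below [y], so [x + z <= y] as well. *)
Lemma oadd_subK x y : (x <= y)%O -> exists z, y = oadd x z.
Proof.
move=> xy; have le_add z : (z <= oadd x z)%O.
  rewrite -[leLHS]add0o leNgt; apply/negP => h.
  suff: (oadd ozero z <= oadd x z)%O by rewrite leNgt h.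
  elim/Ord_ind: z {h} => z IH; apply/oadd_leP; split; first exact: le0o.
  by move=> w wz; apply: le_lt_trans (IH _ wz) _; apply: oadd_ltr.
have [|z [yz zmin]] := @ord_least [set z | (y <= oadd x z)%O].
  by exists y; apply: le_add.
exists z; apply/eqP; rewrite eq_le yz; apply/oadd_leP; split=> // w wz.
by rewrite ltNge; apply: contraL wz => /zmin; rewrite leNgt.
Qed.

Lemma omuln_div w y k : (y < omuln w k)%O ->
  exists a r, [/\ (a < k)%N, (r < w)%O & y = oadd (omuln w a) r].
Proof.
elim: k => [|k IH]; first by rewrite ltNge le0o.
have [yk _|wy yk] := ltP y (omuln w k).
  by have [a [r [ak rw ->]]] := IH yk; exists a, r; split=> //; apply: leqW.
have [r yr] := oadd_subK _ _ wy; exists k, r; split=> //.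
by rewrite -(oadd_lt2 (omuln w k)) -yr.
Qed.

Lemma lt_oexp_limit xi y : olimit xi -> (y < oexp xi)%O ->
  exists2 zeta, (zeta < xi)%O & (y < oexp (osucc zeta))%O.
Proof.
move=> lxi yxi; apply: contrapT => h.
have ge zeta : (zeta < xi)%O -> (oexp (osucc zeta) <= y)%O.
  by move=> zxi; rewrite leNgt; apply/negP => yz; apply: h; exists zeta.
have xi0 : (ozero < xi)%O.
  by rewrite lt_neqAle le0o andbT; apply/eqP => e; case: lxi => /(_ (esym e)).
move: yxi; rewrite ltNge => /negP; apply; apply/oexp_leP; split.
  exact: lt_le_trans (oexp_gt0 _) (ge _ xi0).
by move=> z zxi n; apply/ltW/(lt_le_trans (omuln_oexp_lt n (osucc_gt z)))/ge.
Qed.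

(** * Initial segments and maximal members of the sets Gamma *)

Lemma prefix_oshift w s t : prefix (oshift w s) (oshift w t) = prefix s t.
Proof.
elim: s t => [|x s IH] [|y t] //=.
by rewrite IH (inj_eq (@oadd_inj w)).
Qed.

Lemma oshift_inj w : injective (oshift w).
Proof. exact/inj_map/oadd_inj. Qed.

(** Closure of [Gamma xi] is a hypothesis here, so that the lemma can be applied inside the
    transfinite induction that proves this closure. *)
Lemma take_Gamman_of xi n t k :
  (forall s k, Gamma xi s -> (0 < k)%N -> Gamma xi (take k s)) ->
  Gamman xi n t -> (0 < k)%N -> Gamman xi n (take k t).
Proof.
move=> G; elim: n t k => [//|n IH] t k; have [->|n0] := posnP n.
  by rewrite Gamman1; apply: G.
rewrite GammanS // => -[[s sG <-]|[_ [[s sG <-] sM] [u uG <-]]] k0.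
  by left; exists (take k s); rewrite /oshift ?map_take //; apply: G.
rewrite take_cat; case: ltnP => [_|sk].
  by left; exists (take k s); rewrite /oshift ?map_take //; apply: G.
set j := (k - _)%N; have [->|j0] := posnP j.
  by rewrite take0 cats0; left; exists s.
by right; exists (oshift (omuln (oexp xi) n) s); [split=> //; exists s|];
  exists (take j u) => //; apply: IH.
Qed.

Lemma take_Gamma xi s k : Gamma xi s -> (0 < k)%N -> Gamma xi (take k s).
Proof.
elim/Ord_ind: xi s k => xi IH s k; case: (ord_cases xi) => [->|[z e]|lxi].
- by rewrite Gamma0 => ->; case: k.
- rewrite e GammaS => -[n n0 sG] k0; exists n => //.
  by apply: take_Gamman_of => // t j; apply: IH; rewrite e osucc_gt.
- rewrite Gamma_lim // => -[z zxi [t tG <-]] k0; exists z => //.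
  exists (take k t); rewrite /oshift ?map_take //.
  by apply: IH => //; apply: olimit_succ.
Qed.

Lemma take_Gamman xi n t k :
  Gamman xi n t -> (0 < k)%N -> Gamman xi n (take k t).
Proof. by apply: take_Gamman_of => *; apply: take_Gamma. Qed.

Lemma Gamma_neq0 xi s : Gamma xi s -> s != [::].
Proof. by case/Gamma_bound. Qed.

Lemma Gamman_neq0 xi n s : Gamman xi n s -> s != [::].
Proof. by case/(Gamman_bound (@Gamma_bound xi)). Qed.

(** Successive blocks are shifted by smaller and smaller multiples of omega^xi, and a later block
    lies entirely below the shift of an earlier one. *)
Lemma Gamma_decreasing xi s : Gamma xi s -> pairwise (>%O : rel Ord) s.
Proof.
have shift w t : pairwise (>%O : rel Ord) t -> pairwise (>%O : rel Ord) (oshift w t).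
  move=> tD; rewrite pairwise_map; apply: sub_pairwise tD => x y /=.
  by rewrite oadd_lt2.
elim/Ord_ind: xi s => xi IH s; case: (ord_cases xi) => [->|[z e]|lxi].
- by rewrite Gamma0 => ->.
- rewrite e GammaS => -[n _]; have {}IH t : Gamma z t -> pairwise (>%O : rel Ord) t.
    by apply: IH; rewrite e osucc_gt.
  elim: n s => [//|n IHn] s; have [->|n0] := posnP n; first exact: IH.
  rewrite GammanS // => -[[t /IH tD <-]|[_ [[t /IH tD <-] _] [u uG <-]]].
    exact: shift.
  rewrite pairwise_cat shift // (IHn u) // !andbT.
  apply/allrelP => _ y /mapP[x _ ->] yu.
  exact: lt_le_trans (Gamman_lt uG yu) (oadd_gel _ _).
- rewrite Gamma_lim // => -[z zxi [t tG <-]].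
  by apply/shift/(IH (osucc z)) => //; apply: olimit_succ.
Qed.

Lemma prefix_comparable (s t z : seq Ord) :
  prefix s z -> prefix t z -> prefix s t || prefix t s.
Proof.
wlog st : s t / (size s <= size t)%N.
  move=> H sz tz; case/orP: (leq_total (size s) (size t)) => h; first exact: H.
  by rewrite orbC; apply: H.
rewrite !prefixE => /eqP sz /eqP tz.
by rewrite -[in take _ t]tz take_takel // sz eqxx.
Qed.

(** The first block of an extension is comparable with [t], so maximality makes it [t]. The
    extension cannot stop there, since [u] is nonempty, and its remainder extends [u]. *)
Lemma MAX_Gamman_cat xi n t u :
  (0 < n)%N -> MAX (Gamma xi) t -> MAX (Gamman xi n) u ->
  MAX (Gamman xi n.+1) (oshift (omuln (oexp xi) n) t ++ u).
Proof.
move=> n0 [tG tM] [uG uM]; set w := omuln _ _.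
rewrite GammanS // -/w; split.
  right; exists (oshift w t); last by exists u.
  split; first by exists t.
  by move=> _ [s sG <-]; rewrite prefix_oshift => /(tM _ sG) ->.
move=> _ [[s sG <-] tus|[_ [[s sG <-] sM] [v vG <-]] tuv].
  have st : s = t by apply: tM => //; rewrite -(prefix_oshift w); apply: catl_prefix tus.
  have := size_prefix tus; rewrite st size_cat -[leqRHS]addn0 leq_add2l leqn0.
  by rewrite size_eq0 (negPf (Gamman_neq0 _ _ _ uG)).
have [_ {}sM] : MAX (Gamma xi) s by apply: (@MAX_oshift w); split=> //; exists s.
have st : s = t.
  have := prefix_comparable _ _ _ (catl_prefix tuv) (prefix_prefix (oshift w s) v).
  by rewrite !prefix_oshift => /orP[/(tM _ sG)|/(sM _ tG)->].
move: tuv; rewrite st prefix_catr // eqxx /= => uv.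
by rewrite (uM v).
Qed.

(** An extension of [t] may a priori lie in another [Gamman xi m]. Closure under initial segments
    then puts [t] there too, and disjointness gives [m = n]. *)
Lemma MAX_GammanW xi n t :
  (0 < n)%N -> MAX (Gamman xi n) t -> MAX (Gamma (osucc xi)) t.
Proof.
move=> n0 [tG tM]; rewrite GammaS; split; first by exists n.
move=> s [m m0 sG] ts; apply: tM => //.
have t0 : (0 < size t)%N by rewrite lt0n size_eq0 (Gamman_neq0 _ _ _ tG).
move: (ts); rewrite prefixE => /eqP e.
have := take_Gamman _ _ _ _ sG t0; rewrite e => tm.
by rewrite (Gamman_disj tG tm).
Qed.

Lemma MAX_Gamma_lim xi zeta t : olimit xi -> (zeta < xi)%O ->
  MAX (Gamma (osucc zeta)) t -> MAX (Gamma xi) (oshift (oexp zeta) t).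
Proof.
move=> lxi zxi [tG tM]; rewrite Gamma_lim //; split; first by exists zeta => //; exists t.
move=> _ [z zx [s sG <-]] ts; move: (ts); rewrite prefixE size_map => /eqP e.
have t0 : (0 < size t)%N by rewrite lt0n size_eq0 (Gamma_neq0 _ _ tG).
have [ez tE] : zeta = z /\ t = take (size t) s.
  apply: (Gamma_lim_disj zxi zx tG (take_Gamma _ _ _ sG t0)).
  by rewrite -e /oshift map_take.
by move: ts; rewrite ez prefix_oshift => /(tM s); rewrite ez => ->.
Qed.

Lemma tail_block_oshift xi n s : Gamma xi s ->
  tail_block xi n.+1 (oshift (omuln (oexp xi) n) s) = s.
Proof.
move=> sG; rewrite (@tail_blockE _ _ _ [:: s]) //.
by apply/Gamman_decomp_cons; split=> //; left.
Qed.

Lemma tail_block_cat xi n s v : MAX (Gamma xi) s -> Gamman xi n v ->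
  tail_block xi n.+1 (oshift (omuln (oexp xi) n) s ++ v) = tail_block xi n v.
Proof.
move=> sM /Gamman_decomp_ex[ts tsv].
rewrite (@tail_blockE _ n.+1 _ (s :: ts)); last first.
  by apply/Gamman_decomp_cons; split; [case: sM|right; split=> //; exists v].
rewrite (tail_blockE tsv); case: ts tsv => //.
by case.
Qed.

(** * Mass of a set along a branch *)

Lemma PP_ge0 (R : realType) xi t : 0 <= PP R xi t.
Proof.
rewrite /PP; case: xgetP => // p _ /=; elim=> //.
by move=> {}xi n s q _ _ _ q0; rewrite mulr_ge0.
Qed.

Fixpoint prefixes (t : seq Ord) : seq (seq Ord) :=
  if t is x :: t' then [:: x] :: map (cons x) (prefixes t') else [::].

Lemma prefixes_neq0 t : [::] \notin prefixes t.
Proof. by case: t => //= x t; apply/negP => /mapP[]. Qed.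

Lemma mem_prefixes s t : (s \in prefixes t) = (s != [::]) && prefix s t.
Proof.
elim: t s => [|x t IH] [|y s] //=; rewrite inE /=.
  by apply/negP => /mapP[].
rewrite eqseq_cons; case: (eqVneq y x) => [->|yx] /=; last first.
  by apply/negP => /mapP[u _ [e _]]; rewrite e eqxx in yx.
rewrite mem_map; last by move=> ? ? [].
by rewrite IH; case: s => //; rewrite prefix0s.
Qed.

Lemma uniq_prefixes t : uniq (prefixes t).
Proof.
elim: t => //= x t IH; rewrite map_inj_uniq ?IH ?andbT; last by move=> ? ? [].
by apply/negP => /mapP[u + [e]]; rewrite -e (negPf (prefixes_neq0 _)).
Qed.

Lemma prefixes_cat s u : prefixes (s ++ u) = prefixes s ++ map (cat s) (prefixes u).
Proof.
elim: s => [|x s IH] /=; first by rewrite map_id.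
by rewrite IH map_cat -map_comp.
Qed.

Lemma prefixes_oshift w t : prefixes (oshift w t) = map (oshift w) (prefixes t).
Proof. by elim: t => //= x t ->; rewrite -!map_comp. Qed.

Lemma prefixes_Gamma xi s t : Gamma xi t -> s \in prefixes t -> Gamma xi s.
Proof.
move=> tG; rewrite mem_prefixes prefixE => /andP[s0 /eqP <-].
by apply: take_Gamma => //; rewrite lt0n size_eq0.
Qed.

Lemma prefixes_Gamman xi n s t : Gamman xi n t -> s \in prefixes t -> Gamman xi n s.
Proof.
move=> tG; rewrite mem_prefixes prefixE => /andP[s0 /eqP <-].
by apply: take_Gamman => //; rewrite lt0n size_eq0.
Qed.

Definition mass (R : realType) xi (A : set (seq Ord)) t : R :=
  \sum_(s <- prefixes t | `[< A s >]) PP R xi s.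

(* n times the mass that P_(xi+1) gives to A along t, for t in Gamma_{xi,n}; see
   mass_succ. *)
Definition massn (R : realType) xi n (A : set (seq Ord)) t : R :=
  \sum_(s <- prefixes t | `[< A s >]) PP R xi (tail_block xi n s).

Lemma massn_nil (R : realType) xi n A : massn R xi n A [::] = 0.
Proof. by rewrite /massn big_nil. Qed.

Lemma massn_oshift (R : realType) xi n A s : Gamma xi s ->
  massn R xi n.+1 A (oshift (omuln (oexp xi) n) s) =
  mass R xi [set v | A (oshift (omuln (oexp xi) n) v)] s.
Proof.
move=> sG; rewrite /massn prefixes_oshift big_map big_seq_cond [RHS]big_seq_cond.
apply: eq_bigr => v /andP[vs _]; rewrite tail_block_oshift //.
exact: prefixes_Gamma vs.
Qed.

(** Beyond the first block, the tail block depends only on the part [u] in the later blocks. The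
    case [u = [::]] serves the last block, where [n = 0]. *)
Lemma massn_cat (R : realType) xi n A s u :
  MAX (Gamma xi) s -> u = [::] \/ Gamman xi n u ->
  massn R xi n.+1 A (oshift (omuln (oexp xi) n) s ++ u) =
  mass R xi [set v | A (oshift (omuln (oexp xi) n) v)] s +
  massn R xi n [set v | A (oshift (omuln (oexp xi) n) s ++ v)] u.
Proof.
move=> sM uG; rewrite -massn_oshift; last by case: sM.
rewrite /massn prefixes_cat big_cat; congr (_ + _); rewrite big_map.
case: uG => [->|uG]; first by rewrite !big_nil.
rewrite big_seq_cond [RHS]big_seq_cond.
apply: eq_bigr => v /andP[vu _]; rewrite tail_block_cat //.
exact: prefixes_Gamman vu.
Qed.

Lemma mass_succ (R : realType) xi n A t : (0 < n)%N -> Gamman xi n t ->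
  mass R (osucc xi) A t = n%:R^-1 * massn R xi n A t.
Proof.
move=> n0 tG; rewrite /mass /massn mulr_sumr big_seq_cond [RHS]big_seq_cond.
apply: eq_bigr => s /andP[st _]; rewrite (@PPS _ _ n) //.
exact: prefixes_Gamman st.
Qed.

Lemma mass_lim (R : realType) xi zeta A t :
  olimit xi -> (zeta < xi)%O -> Gamma (osucc zeta) t ->
  mass R xi A (oshift (oexp zeta) t) =
  mass R (osucc zeta) [set s | A (oshift (oexp zeta) s)] t.
Proof.
move=> lxi zxi tG; rewrite /mass prefixes_oshift big_map big_seq_cond [RHS]big_seq_cond.
apply: eq_bigr => s /andP[st _]; rewrite PP_lim //.
exact: prefixes_Gamma st.
Qed.

(** At a successor, a branch of [Gamman z n] meets at most [n] blocks, each of mass at most 1 by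
    induction, and the factor 1/n compensates. *)
Lemma mass_le1 (R : realType) xi A t : Gamma xi t -> mass R xi A t <= 1.
Proof.
elim/Ord_ind: xi A t => xi IH A t; case: (ord_cases xi) => [->|[z e]|lxi].
- rewrite Gamma0 => ->; rewrite /mass /= big_mkcond big_seq1 PP0.
  by case: ifP.
- rewrite e GammaS => -[n n0 tG]; rewrite (@mass_succ _ _ n) //.
  rewrite mulrC ler_pdivrMr ?ltr0n // mul1r.
  have {}IH B s : Gamma z s -> mass R z B s <= 1 by apply: IH; rewrite e osucc_gt.
  elim: n t A {n0} tG => [//|n IHn] t A; have [->|n0] := posnP n.
    move=> tG; have := massn_oshift R z 0 A _ tG.
    by rewrite oshift0 => ->; apply: IH.
  rewrite GammanS // => -[[s sG <-]|[_ [[s sG <-] sM] [u uG <-]]].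
    by rewrite massn_oshift // (le_trans (IH _ _ sG)) // ler1n.
  rewrite massn_cat; [|by apply: (@MAX_oshift (omuln (oexp z) n)); split=> //; exists s
                     |by right].
  by rewrite -natr1 addrC lerD ?IH ?IHn.
- rewrite Gamma_lim // => -[z zxi [s sG <-]]; rewrite mass_lim //.
  by apply: IH => //; apply: olimit_succ.
Qed.

Lemma le_mass (R : realType) xi (A B : set (seq Ord)) t :
  (forall s, s \in prefixes t -> A s -> B s) -> mass R xi A t <= mass R xi B t.
Proof.
move=> AB; rewrite /mass big_mkcond [leRHS]big_mkcond big_seq [leRHS]big_seq.
apply: ler_sum => s st; case: asboolP => [/(AB _ st) Bs|_].
  by rewrite (asboolT Bs).
by case: ifP => // _; apply: PP_ge0.
Qed.

(** * Rankings of sets of sequences, and the embedding dichotomy *)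

Definition ranking (A : set (seq Ord)) (h : seq Ord -> Ord) : Prop :=
  forall s t, A s -> A t -> proper_prefix s t -> (h t < h s)%O.

Definition ranked (A : set (seq Ord)) (h : seq Ord -> Ord) (rho : Ord) : Prop :=
  ranking A h /\ forall s, A s -> (h s < rho)%O.

Lemma proper_prefix_oshift w s t :
  proper_prefix s t -> proper_prefix (oshift w s) (oshift w t).
Proof.
by rewrite /proper_prefix prefix_oshift (inj_eq (oshift_inj w)).
Qed.

Lemma proper_prefix_cat u s t :
  proper_prefix s t -> proper_prefix (u ++ s) (u ++ t).
Proof.
by rewrite /proper_prefix prefix_catr // eqseq_cat // eqxx.
Qed.

Lemma proper_prefix_trans s t u :
  proper_prefix s t -> proper_prefix t u -> proper_prefix s u.
Proof.
move=> /andP[st nst] /andP[tu ntu]; rewrite /proper_prefix (prefix_trans st tu) /=.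
apply/eqP => su; move: tu nst; rewrite -su => ts.
suff -> : s = t by rewrite eqxx.
have := size_prefix ts; move: st; rewrite prefixE => /eqP st le_ts.
by rewrite -st take_oversize.
Qed.

Lemma Gamma_last_ranking xi : ranking (Gamma xi) (last ozero).
Proof.
move=> s t sG /Gamma_decreasing tD /andP[/prefixP[[|y u] e]].
  by rewrite e cats0 eqxx.
move: tD; rewrite e pairwise_cat last_cat => /andP[/allrelP su _] _; apply: su.
  by case: s {e} sG => [/Gamma_neq0//|x s _]; rewrite /= mem_last.
by rewrite /= mem_last.
Qed.

(** The pointwise minimum of all rankings is itself a ranking: if [k] attains it at [s], then
    [h t <= k t < k s = h s] for every proper extension [t] of [s] in [A]. *)
Lemma min_ranking A h0 : ranking A h0 ->
  exists2 h, ranking A h & forall k, ranking A k -> forall s, (h s <= k s)%O.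
Proof.
move=> h0A.
have /choice[h hP] : forall s, exists y, (exists2 k, ranking A k & y = k s) /\
    forall k, ranking A k -> (y <= k s)%O.
  move=> s; have [|y [[k kA <-] ymin]] := @ord_least [set k s | k in ranking A].
    by exists (h0 s), h0.
  by exists (k s); split=> [|k' k'A]; [exists k | apply: ymin; exists k'].
exists h => [s t As At st|k kA s]; last exact: (hP s).2.
have [[k kA ->] _] := hP s.
by apply: le_lt_trans (kA _ _ As At st); apply: (hP t).2.
Qed.

(** If all proper extensions of [s] in [A] had rank below [x], lowering the value at [s] to [x]
    would still give a ranking, against minimality. *)
Lemma min_ranking_attained A h : ranking A h ->
  (forall k, ranking A k -> forall s, (h s <= k s)%O) ->
  forall s x, A s -> (x < h s)%O ->
  exists t, [/\ A t, proper_prefix s t & (x <= h t)%O].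
Proof.
move=> hA hmin s x As xs; apply: contrapT => /forallNP no.
suff /hmin/(_ s) : ranking A (fun t => if t == s then x else h t).
  by rewrite eqxx leNgt xs.
move=> t u At Au tu /=; have [us|us] := eqVneq u s; have [ts|ts] := eqVneq t s.
- by move: tu; rewrite /proper_prefix us ts eqxx andbF.
- by apply: lt_trans xs _; rewrite -us; apply: hA.
- by rewrite ltNge; apply/negP => xu; apply: (no u); split=> //; rewrite -ts.
- exact: hA.
Qed.

(* Members of Gamma xi are decreasing sequences of ordinals below omega^xi. Unless
   the minimal ranking is bounded below omega^xi, such a sequence x_1 > ... > x_k
   is mapped to the end of a chain a_1, ..., a_k of proper extensions in A where
   a_i has rank at least x_i. *)
Lemma ranked_or_embeds xi A : A `<=` Gamma xi ->
  (exists h rho, (rho < oexp xi)%O /\ ranked A h rho) \/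
  (exists2 theta, Gamma_monotone xi theta & forall t, Gamma xi t -> A (theta t)).
Proof.
move=> AG.
have A0 : ~ A [::] by move=> /AG/Gamma_neq0.
have [h hA hmin] : exists2 h, ranking A h & forall k, ranking A k -> forall s, (h s <= k s)%O.
  apply: (@min_ranking _ (last ozero)) => s t As At.
  by apply: Gamma_last_ranking; apply: AG.
have [[rho rhox hrho]|unb] := pselect (exists2 rho, (rho < oexp xi)%O &
    forall s, A s -> (h s < rho)%O).
  by left; exists h, rho.
(* The empty sequence lies outside [A] and serves as a root of rank omega^xi. From it every rank
   below omega^xi is reached, because [h] is not bounded below omega^xi on [A]. *)
right; pose H a := if a == [::] then oexp xi else h a.
pose ok a y := (a = [::] \/ A a) /\ (y <= H a)%O.
pose step a x := xget [::] [set b | [/\ A b, proper_prefix a b & (x <= h b)%O]].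
have stepP a y x : ok a y -> (x < y)%O ->
    [/\ ok (step a x) x, A (step a x) & proper_prefix a (step a x)].
  move=> [aA ya] xy.
  have [b bP] : exists b, [/\ A b, proper_prefix a b & (x <= h b)%O].
    case: (eqVneq a [::]) aA ya => [->|a0] aA; rewrite /H ?(negPf a0) ?eqxx => ya.
      apply: contrapT => /forallNP no; apply: unb; exists x.
        exact: lt_le_trans ya.
      move=> s As; rewrite ltNge; apply/negP => xs; apply: (no s); split=> //.
      by rewrite /proper_prefix prefix0s; apply/eqP => e; apply: A0; rewrite e.
    apply: (min_ranking_attained _ _ hA hmin); first by case: aA a0 => // ->.
    exact: lt_le_trans ya.
  have [sA as_ xs] : [set b | [/\ A b, proper_prefix a b & (x <= h b)%O]] (step a x).
    exact: (xgetI _ bP).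
  split=> //; split; first by right.
  by rewrite /H ifF //; apply/eqP => e; apply: A0; rewrite -e.
have foldlP t a y : ok a y -> path (>%O) y t ->
    ok (foldl step a t) (last y t) /\
    (t != [::] -> A (foldl step a t) /\ proper_prefix a (foldl step a t)).
  elim: t a y => [|x t IH] a y //= ay /andP[xy xt].
  have [okx Ax ax] := stepP _ _ _ ay xy.
  have [okt At] := IH _ _ okx xt; split=> // _.
  case: t {IH xt okt} At => [//|z t] /(_ isT)[At xt].
  by split=> //; apply: proper_prefix_trans xt.
have start : ok [::] (oexp xi) by split; [left|rewrite /H eqxx].
have Gpath t : Gamma xi t -> path (>%O) (oexp xi) t.
  move=> tG; have : sorted (>%O : rel Ord) t.
    rewrite sorted_pairwise; last exact: rev_trans lt_trans.
    exact: Gamma_decreasing tG.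
  case: t tG => //= x t /Gamma_bound[_ B] ->; rewrite andbT.
  by apply: B; rewrite inE eqxx.
have thA t : Gamma xi t -> A (foldl step [::] t).
  move=> tG; have [_] := foldlP _ _ _ start (Gpath _ tG).
  by case/(_ (Gamma_neq0 _ _ tG)).
exists (foldl step [::]) => //; split=> [t /thA/AG//|s t sG tG /andP[/prefixP[u e] st]].
move: (Gpath _ tG); rewrite e foldl_cat cat_path => /andP[sp up].
have [okS _] := foldlP _ _ _ start sp.
have [_] := foldlP _ _ _ okS up; case=> [|_ //].
by apply: contra_neq st => u0; rewrite e u0 cats0.
Qed.

(** * Branches of small mass, by transfinite induction *)

(** The coefficient [a] acts as a potential. If the block meets a member of [A] of rank below
    omega^xi a, all that follows has rank below that one, so the coefficient drops by at least 1 and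
    pays for the block's mass. Otherwise the coefficient stays and the mass is at most [eta]. *)
Lemma ranked_block (R : realType) xi n A h (a : nat) r eta t :
  (0 <= eta :> R) -> MAX (Gamma xi) t -> (r < oexp xi)%O ->
  let w := omuln (oexp xi) n in
  ranked A h (oadd (omuln (oexp xi) a) r) ->
  mass R xi [set s | A (oshift w s) /\ (omuln (oexp xi) a <= h (oshift w s))%O] t <= eta ->
  exists ar : nat * Ord, [/\ (ar.2 < oexp xi)%O,
    ranked [set v | v != [::] /\ A (oshift w t ++ v)] (fun v => h (oshift w t ++ v))
      (oadd (omuln (oexp xi) ar.1) ar.2)
    & mass R xi [set s | A (oshift w s)] t + ar.1%:R <= eta + a%:R].
Proof.
move=> eta0 [tG _] rxi w [hA hb] small.
have rk : ranking [set v | v != [::] /\ A (oshift w t ++ v)] (fun v => h (oshift w t ++ v)).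
  by move=> u v [_ Au] [_ Av] uv; apply: hA => //; apply: proper_prefix_cat.
have [[s [st As hs]]|no] := pselect (exists s, [/\ s \in prefixes t,
    A (oshift w s) & (h (oshift w s) < omuln (oexp xi) a)%O]).
  have [b [q [ba qxi e]]] := omuln_div _ _ _ hs.
  exists (b, q); split=> //=.
    split=> // v [v0 Av]; rewrite -e; apply: hA => //.
    move: st; rewrite mem_prefixes => /andP[_ /prefixP[u ->]].
    rewrite /proper_prefix /oshift map_cat -catA prefix_prefix /=.
    apply/eqP => /(congr1 size)/eqP; rewrite !size_cat -[X in X == _]addn0 eqn_add2l.
    by rewrite eq_sym addn_eq0 !size_eq0 (negPf v0) andbF.
  apply: (@le_trans _ _ a%:R); last by rewrite lerDr.
  apply: le_trans (_ : 1 + b%:R <= _); first by rewrite lerD2r mass_le1.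
  by rewrite addrC natr1 ler_nat.
exists (a, r); split=> //=; first by split=> // v [_ Av]; apply: hb.
rewrite lerD2r (le_trans _ small) //; apply: le_mass => s st As; split=> //.
by rewrite leNgt; apply/negP => hs; apply: no; exists s.
Qed.

(** A single branch must serve the whole finite family. The [A i] are arbitrary sets of sequences,
    so that the induction can pull them back along shifts and concatenations. *)
Definition small_branch (R : realType) xi : Prop :=
  forall m (A : 'I_m -> set (seq Ord)) h (rho : 'I_m -> Ord) (eta : R),
  (forall i, rho i < oexp xi)%O -> (forall i, ranked (A i) (h i) (rho i)) -> 0 < eta ->
  exists2 t, MAX (Gamma xi) t & forall i, mass R xi (A i) t <= eta.

Lemma small_branchn (R : realType) xi : small_branch R xi ->
  forall n m (A : 'I_m -> set (seq Ord)) h (a : 'I_m -> nat) (r : 'I_m -> Ord) (eta : R),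
  (forall i, r i < oexp xi)%O ->
  (forall i, ranked (A i) (h i) (oadd (omuln (oexp xi) (a i)) (r i))) -> 0 < eta ->
  exists2 u, (if n is 0 then u = [::] else MAX (Gamman xi n) u) &
    forall i, massn R xi n (A i) u <= eta * n%:R + (a i)%:R.
Proof.
move=> IHxi; elim=> [|n IHn] m A h a r eta rxi Ah eta0.
  by exists [::] => // i; rewrite massn_nil mulr0 add0r ler0n.
set w := omuln (oexp xi) n.
(* Subtracting omega^xi a_i from the ranks on [B i] leaves a ranking below [r i], to which the
   hypothesis at [xi] applies. *)
pose B i := [set s | A i (oshift w s) /\ (omuln (oexp xi) (a i) <= h i (oshift w s))%O].
have /choice[k kP] : forall i, exists k, ranked (B i) k (r i).
  move=> i; have [hA hb] := Ah i.
  have /choice[k kP] : forall s, exists z, B i s ->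
      h i (oshift w s) = oadd (omuln (oexp xi) (a i)) z.
    move=> s; have [[_ /oadd_subK[z ->]]|nB] := pselect (B i s); first by exists z.
    by exists ozero.
  exists k; split=> [s t Bs Bt st|s Bs].
    rewrite -(oadd_lt2 (omuln (oexp xi) (a i))) -!kP //.
    by case: Bs Bt => As _ [At _]; apply: hA => //; apply: proper_prefix_oshift.
  by rewrite -(oadd_lt2 (omuln (oexp xi) (a i))) -kP //; apply: hb; case: Bs.
have [t tM tB] := IHxi m B k r eta rxi kP eta0.
have /choice[ar arP] := fun i => ranked_block R xi n (A i) (h i) (a i) (r i) eta t
  (ltW eta0) tM (rxi i) (Ah i) (tB i).
(* The empty [v] stands for the end of the block just chosen: its mass is already counted, and its
   rank need not obey the new bound. *)
have [i|i|//|u uM uA] := IHn m (fun i => [set v | v != [::] /\ A i (oshift w t ++ v)])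
    (fun i v => h i (oshift w t ++ v)) (fun i => (ar i).1) (fun i => (ar i).2) eta.
- by case: (arP i).
- by case: (arP i).
exists (oshift w t ++ u).
  case: (n) @w uM {uA tB k kP B arP IHn} => [|n'] w uM; last exact: MAX_Gamman_cat.
  by rewrite uM cats0 /w oshift0 Gamman1.
move=> i; rewrite massn_cat //; last first.
  by case: (n) uM => [->|n' [uG _]]; [left|right].
have [_ _ ar_le] := arP i; have {uA} := uA i.
have -> : massn R xi n [set v | v != [::] /\ A i (oshift w t ++ v)] u =
  massn R xi n [set v | A i (oshift w t ++ v)] u.
  rewrite /massn big_mkcond [RHS]big_mkcond big_seq [RHS]big_seq; apply: eq_bigr => v.
  rewrite mem_prefixes => /andP[v0 _]; congr (if _ then _ else _).
  by apply/asboolP/asboolP => [[]//|].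
by rewrite -natr1; lra.
Qed.

Lemma small_branch_holds (R : realType) xi : small_branch R xi.
Proof.
elim/Ord_ind: xi => xi IH m A h rho eta; case: (ord_cases xi) => [->|[z e]|lxi].
- move=> rho0 Ah eta0; exists [:: ozero].
    by rewrite Gamma0; split=> // t ->.
  (* As omega^0 = 1, the bound [rho i] is 0 and [A i] is empty. *)
  move=> i; rewrite /mass /= big_mkcond big_seq1 asboolF ?ltW // => /(Ah i).2.
  move=> /lt_le_trans/(_ (_ : _ <= ozero)%O); rewrite ltNge le0o => H.
  by have := rho0 i; rewrite oexp0 lt_osucc => /H.
- rewrite e => rhox Ah eta0.
  have /choice[ar arP] : forall i, exists ar : nat * Ord,
      (ar.2 < oexp z)%O /\ rho i = oadd (omuln (oexp z) ar.1) ar.2.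
    move=> i; have [k /omuln_div[a [r [_ rz ->]]]] := oexpS_lt (rhox i).
    by exists (a, r).
  pose K := (\sum_i (ar i).1)%N.
  (* With this many blocks [K <= (eta / 2) n]. Since [K] bounds every coefficient, the total
     [(eta / 2) n + a_i] is at most [eta n], and the weight 1/n leaves [eta]. *)
  pose n := (Num.bound (K%:R / (eta / 2))).+1.
  have eta2 : 0 < eta / 2 by rewrite divr_gt0.
  have := @small_branchn R z (IH z _) n m A h (fun i => (ar i).1) (fun i => (ar i).2) (eta / 2).
  rewrite e osucc_gt => /(_ isT) [| |//|u uM uA].
    by move=> i; case: (arP i).
    by move=> i; case: (arP i) => _ <-.
  exists u; first exact: MAX_GammanW uM.
  move=> i; rewrite (@mass_succ _ _ n) //; last by case: uM.
  rewrite mulrC ler_pdivrMr ?ltr0n // (le_trans (uA i)) //.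
  have -> : eta * n%:R = eta / 2 * n%:R + eta / 2 * n%:R by lra.
  rewrite lerD2l; apply: (@le_trans _ _ K%:R).
    by rewrite ler_nat /K (bigD1 i) //= leq_addr.
  rewrite mulrC -ler_pdivrMr //; apply: ltW.
  apply: (@lt_trans _ _ (Num.bound (K%:R / (eta / 2)))%:R); last by rewrite ltr_nat.
  by apply: archi_boundP; rewrite divr_ge0 // ltW.
- move=> rhox Ah eta0.
  have /choice[zs zsP] : forall i, exists z, (z < xi)%O /\ (rho i < oexp (osucc z))%O.
    by move=> i; have [z] := lt_oexp_limit _ _ lxi (rhox i); exists z.
  (* One exponent for the whole family: a maximum of finitely many ordinals below the limit [xi]
     stays below it, and so does the default 0. *)
  pose z := \big[Order.max/ozero]_i zs i.
  have zxi : (z < xi)%O.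
    rewrite /z; apply: (big_ind (fun y => y < xi)%O).
    - by rewrite lt_neqAle le0o andbT; apply/eqP => e0; case: lxi => /(_ (esym e0)).
    - by move=> x y xx yx; rewrite gt_max xx yx.
    - by move=> i _; case: (zsP i).
  have zz i : (rho i < oexp (osucc z))%O.
    have [_ /lt_le_trans] := zsP i; apply.
    have zi : (zs i <= z)%O by apply: le_bigmax.
    by case: ltgtP zi => // [zi _|-> //]; apply/ltW/oexp_lt; rewrite lt_osucc osucc_le.
  have [|t tM tA] := IH _ (olimit_succ lxi zxi) m
     (fun i => [set s | A i (oshift (oexp z) s)])
     (fun i s => h i (oshift (oexp z) s)) rho eta zz _ eta0.
    move=> i; have [hA hb] := Ah i; split=> [s u As Au su|s As]; last exact: hb.
    by apply: hA => //; apply: proper_prefix_oshift.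
  exists (oshift (oexp z) t); first exact: MAX_Gamma_lim.
  by move=> i; rewrite mass_lim //; case: tM.
Qed.

(** * From small mass to small branch sums *)

Lemma branch_sumE (R : realType) xi eps f t : Gamma xi t ->
  branch_sum (R := R) xi eps f t = \sum_(s <- prefixes t) PP R xi s * (f s - eps).
Proof.
move=> tG; rewrite [RHS]fsbig_seq ?uniq_prefixes // /branch_sum.
suff -> : Gamma xi `&` [set s | prefix s t] = [set` prefixes t]. by [].
apply/seteqP; split=> s /=.
  by move=> [sG st]; rewrite mem_prefixes (Gamma_neq0 _ _ sG).
by move=> st; split; [apply: prefixes_Gamma st|move: st; rewrite mem_prefixes => /andP[]].
Qed.

(** Where [f s < eps] the term is nonpositive; elsewhere it is at most [C] times the weight of
    [s]. *)
Lemma branch_sum_le_mass (R : realType) xi (eps C : R) f t : Gamma xi t ->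
  (forall s, Gamma xi s -> f s - eps <= C) ->
  branch_sum xi eps f t <= C * mass R xi [set s | Gamma xi s /\ eps <= f s] t.
Proof.
move=> tG fC; rewrite branch_sumE // /mass mulr_sumr [leRHS]big_mkcond.
rewrite big_seq [leRHS]big_seq; apply: ler_sum => s st.
have sG := prefixes_Gamma _ _ _ tG st.
case: asboolP => [_|/not_andP[//|/negP]].
  by rewrite mulrC ler_wpM2r ?PP_ge0 ?fC.
by rewrite -ltNge => fe; rewrite mulr_ge0_le0 ?PP_ge0 // subr_le0 ltW.
Qed.

(** In the other case of the dichotomy, a single embedding into the set where [f >= eps] would
    witness largeness for every [delta]. *)
Lemma not_large_ranked (R : realType) xi (eps : R) f : ~ large xi eps f ->
  exists h rho, (rho < oexp xi)%O /\ ranked [set s | Gamma xi s /\ eps <= f s] h rho.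
Proof.
move=> nl; have [//|[theta mono thA]] := @ranked_or_embeds xi
  [set s | Gamma xi s /\ eps <= f s] (fun s => @proj1 _ _).
case: nl => delta d0; exists theta => // t /thA[_].
by apply: le_trans; rewrite gerBl ltW.
Qed.

Theorem theorem1p4 (R : realType) (xi : Ord) (n : nat)
    (eps : 'I_n.+1 -> R) (f : 'I_n.+1 -> seq Ord -> R)
    (f_bounded : forall i, bounded_on_Gamma xi (f i))
    (f_not_large : forall i, ~ large xi (eps i) (f i)) :
  (ereal_inf
     [set (\big[Num.max/branch_sum xi (eps ord0) (f ord0) t]_(i < n.+1)
             branch_sum xi (eps i) (f i) t)%:E | t in MAX (Gamma xi)]
   <= 0%:E)%E.
Proof.
have /choice[C CP] : forall i, exists C, 0 < C /\ forall s, Gamma xi s -> f i s - eps i <= C.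
  move=> i; have [M fM] := f_bounded i.
  exists (`|M| + `|eps i| + 1); split=> [|s /fM fs].
    by rewrite ltr_wpDl // addr_ge0.
  have := ler_norm (- eps i); rewrite normrN.
  by have := ler_norm (f i s); have := ler_norm M; lra.
have /choice[h /choice[rho hP]] := fun i => not_large_ranked _ _ _ _ (f_not_large i).
apply/lee_addgt0Pr => e e0; rewrite add0e.
(* [D] dominates every [C i], so mass at most [e / D] keeps each branch sum below
   [C i * (e / D) <= e]. *)
pose D := \sum_i C i.
have CD i : C i <= D by rewrite /D (bigD1 i) //= lerDl sumr_ge0 // => j _; case: (CP j) => /ltW.
have D0 : 0 < D by apply: lt_le_trans (CD ord0); case: (CP ord0).
have [t tM tA] := small_branch_holds R xi _ _ h rho (e / D)
  (fun i => proj1 (hP i)) (fun i => proj2 (hP i)) (divr_gt0 e0 D0).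
have le_e i : branch_sum xi (eps i) (f i) t <= e.
  have [tG _] := tM; have [C0 fC] := CP i.
  apply: le_trans (branch_sum_le_mass _ _ _ _ _ _ tG fC) _.
  apply: (@le_trans _ _ (C i * (e / D))); first by rewrite ler_pM2l.
  by rewrite mulrA ler_pdivrMr // mulrC ler_pM2l.
apply: (@le_trans _ _ (\big[Num.max/branch_sum xi (eps ord0) (f ord0) t]_(i < n.+1)
             branch_sum xi (eps i) (f i) t)%:E).
  by apply: ereal_inf_lbound; exists t.
by rewrite lee_fin; apply: bigmax_le.
Qed.
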